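(* Let $G$ be a $2$-tough $2K_2$-free graph with at least three vertices. Then $G$ is Hamiltonian, i.e., $G$ contains a cycle passing through all vertices of $G$.
   Context: All graphs are finite, simple and undirected. $\omega(H)$ denotes the number of connected components of a graph $H$. A graph $G$ is $t$-tough if $|S| \geq t\cdot \omega(G-S)$ for every subset $S\subset V(G)$ with $\omega(G-S)>1$. A graph is $2K_2$-free if it does not contain $2K_2$ (the graph on four vertices consisting of two independent edges) as an induced subgraph. *)

(* Defs.v *)
From mathcomp Require Import all_boot all_order all_algebra.
Set Implicit Arguments. Unset Strict Implicit. Unset Printing Implicit Defensive.
Import GRing.Theory Num.Theory.

Definition simple_graph (T : finType) (e : rel T) : Prop :=
  symmetric e /\ irreflexive e.

Definition del_rel (T : finType) (e : rel T) (S : {set T}) : rel T :=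
  [rel x y | [&& x \notin S, y \notin S & e x y]].

Definition ncomp_del (T : finType) (e : rel T) (S : {set T}) : nat :=
  n_comp (del_rel e S) (~: S).

Definition tough (T : finType) (e : rel T) (t : rat) : Prop :=
  forall S : {set T}, (1 < ncomp_del e S)%N ->
    (t * (ncomp_del e S)%:R <= (#|S|%:R : rat))%R.

Definition twoK2_free (T : finType) (e : rel T) : Prop :=
  ~ exists a b c d : T,
      [/\ uniq [:: a; b; c; d], e a b, e c d &
          ~~ [|| e a c, e a d, e b c | e b d]].

Definition hamiltonian (T : finType) (e : rel T) : Prop :=
  exists s : seq T, [/\ uniq s, (forall x : T, x \in s) & cycle e s].

(* Main.v *)
Require Import Defs.
From mathcomp Require Import all_boot all_order all_algebra.
From mathcomp Require Import zify.
Set Implicit Arguments. Unset Strict Implicit. Unset Printing Implicit Defensive.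

(** Let n be the number of vertices. By 2-toughness an independent set has at
    most n/3 vertices. In a 2K2-free graph the vertices adjacent to neither
    end of an edge are independent, so every edge has degree sum at least 2n/3
    and the set L of vertices of degree less than n/3 is independent.

    A cycle through L exists: toughness and Hall's theorem give pairwise disjoint
    paths a v b, one for each v in L, with a, b outside L. Two paths whose ends
    lie outside L but whose second vertices v, w lie in L can always be joined:
    the edges a v and c w at their ends do not form an induced 2K2 and v, w are
    not adjacent, so a c, a w or v c is an edge; an end that is skipped lies
    outside L, hence may be dropped. The same argument closes the resulting
    single path into a cycle.

    A longest cycle C through L is Hamiltonian: let x be off C. The successors on
    C of the neighbours of x, together with x, are independent, so x has fewer
    than n/3 neighbours on C, while its degree is at least n/3; hence x has a
    neighbour y off C. Let M be the set of neighbours of x or y on C and B the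
    set of their successors. As C is longest, B is independent and not adjacent
    to x, y; as the graph is 2K2-free, M meets every edge of C, so that C is the
    disjoint union of M and B, and all neighbours of B lie in M. But |B| = |M|,
    which contradicts toughness. *)

(** * Hall's theorem on systems of distinct representatives *)

Lemma hall_sdr (I T : finType) (t0 : T) (F : I -> {set T}) (K : {set I}) :
  (forall J : {set I}, J \subset K -> #|J| <= #|\bigcup_(i in J) F i|) ->
  exists2 f : I -> T, {in K &, injective f} & forall i, i \in K -> f i \in F i.
Proof.
have [n] := ubnP #|K|; elim: n => // n IHn in F K * => /ltnSE-leKn hallK.
have [->|[i iK]] := set_0Vmem K.
  by exists (fun=> t0) => i; rewrite inE.
(* A tight proper subfamily [J], if there is one, is represented inside its union [U], and the other
   indices in the sets [F i :\: U]; Hall's condition for these comes from the one for [J :|: J']. *)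
case: (pickP [pred J : {set I} | [&& J \proper K, J != set0 &
   #|J| == #|\bigcup_(i in J) F i|]]) => [J /and3P[ltJK J0 /eqP tightJ]|slack].
- have sJK := proper_sub ltJK; set U := \bigcup_(i in J) F i in tightJ.
  have [||g g_inj gF] := IHn F J.
  + by apply: leq_trans leKn; apply: proper_card.
  + by move=> J' sJ'; apply: hallK; apply: subset_trans sJK.
  have [||h h_inj hF] := IHn (fun i => F i :\: U) (K :\: J).
  + apply: leq_trans leKn; apply: proper_card; rewrite properEneq subsetDl andbT.
    apply: contraNneq J0 => eKJ; rewrite -subset0; apply/subsetP => j jJ.
    by have := subsetP sJK j jJ; rewrite -eKJ inE jJ.
  + move=> J' sJ'; have disJ : [disjoint J & J'].
      rewrite disjoint_sym; apply/pred0P => j /=; apply/andP => -[/(subsetP sJ')].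
      by rewrite inE => /andP[/negP].
    have sJ'K : J' \subset K by apply: subset_trans sJ' (subsetDl _ _).
    have := hallK (J :|: J'); rewrite subUset sJK sJ'K => /(_ isT).
    have -> : \bigcup_(i in J :|: J') F i = U :|: \bigcup_(i in J') (F i :\: U).
      apply/setP => t; rewrite inE; apply/bigcupP/orP => [[j]|].
        rewrite inE => jJJ' tj; have [tU|tU] := boolP (t \in U); first by left.
        right; case/orP: jJJ' => [jJ|jJ']; last by apply/bigcupP; exists j; rewrite // inE tU.
        by case/bigcupP: tU; exists j.
      case=> /bigcupP[j jJ tj]; exists j => //; first by rewrite inE jJ.
        by rewrite inE jJ orbT.
      by move: tj; rewrite inE => /andP[].
    have := cardsU J J'; have := cardsU U (\bigcup_(i in J') (F i :\: U)).
    have -> : J :&: J' = set0 by apply/eqP; rewrite setI_eq0.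
    rewrite cards0; lia.
  have hFU l : l \in K -> l \notin J -> (h l \notin U) && (h l \in F l).
    by move=> lK lJ; rewrite -in_setD hF // inE lJ.
  have gU l : l \in J -> g l \in U by move=> lJ; apply/bigcupP; exists l => //; apply: gF.
  exists (fun j => if j \in J then g j else h j) => [j k jK kK|j jK]; last first.
    by case: ifPn => jJ; [apply: gF | case/andP: (hFU j jK jJ)].
  have [jJ|jJ] := boolP (j \in J); have [kJ|kJ] := boolP (k \in J).
  + exact: g_inj.
  + by move=> eq; move: (hFU k kK kJ); rewrite -eq gU.
  + by move=> eq; move: (hFU j jK jJ); rewrite eq gU.
  + by apply: h_inj; rewrite !inE ?jJ ?kJ.
(* Without a tight subfamily any [t] in [F i] may represent [i]: removing it from the other sets
   costs each union at most one element. *)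
- have [t tFi] : exists t, t \in F i.
    apply/set0Pn; rewrite -card_gt0; have := hallK [set i].
    by rewrite sub1set iK big_set1 cards1 => /(_ isT).
  have [||h h_inj hF] := IHn (fun j => F j :\ t) (K :\ i).
  + by apply: leq_trans leKn; rewrite [ltnRHS](cardsD1 i) iK.
  + move=> J sJ; have [->|J0] := eqVneq J set0; first by rewrite cards0.
    have ltJK : J \proper K by apply: sub_proper_trans sJ (properD1 iK).
    have := slack J; rewrite /= ltJK J0 /= => /eqP neq.
    have := hallK J (proper_sub ltJK).
    have -> : \bigcup_(j in J) (F j :\ t) = (\bigcup_(j in J) F j) :\ t.
      by rewrite setDE big_distrl; apply: eq_bigr => j _; rewrite setDE.
    by have := cardsD1 t (\bigcup_(j in J) F j); case: (t \in _); lia.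
  have hFt l : l \in K -> l != i -> (h l != t) && (h l \in F l).
    by move=> lK li; rewrite -in_setD1 hF // !inE li.
  exists (fun j => if j == i then t else h j) => [j k jK kK|j jK]; last first.
    by case: eqVneq => [->//|ji]; case/andP: (hFt j jK ji).
  case: (eqVneq j i) => [->|ji]; case: (eqVneq k i) => [->//|ki].
  + by move=> eq; move: (hFt k kK ki); rewrite -eq eqxx.
  + by move=> eq; move: (hFt j jK ji); rewrite eq eqxx.
  + by apply: h_inj; rewrite !inE ?ji ?ki.
Qed.

(** * Rerouting a cycle through an outside path *)

Section Cycles.
Variables (T : finType) (e : rel T).
Hypothesis e_sym : symmetric e.

Lemma path_rev_sym (x : T) p : path e (last x p) (rev (belast x p)) = path e x p.
Proof. by rewrite rev_path; apply: eq_path => a b; rewrite /= e_sym. Qed.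

Lemma cycle_cons_last (r : rel T) x p :
  cycle r (x :: p) = path r x p && r (last x p) x.
Proof. by rewrite /= rcons_path. Qed.

Lemma rev_belast (x : T) p : rev (x :: p) = last x p :: rev (belast x p).
Proof. by rewrite lastI rev_rcons. Qed.

Lemma last_rev_belast (x : T) p : last (last x p) (rev (belast x p)) = x.
Proof. by rewrite -(last_cons x) -rev_belast rev_cons last_rcons. Qed.

(** Cutting the cycle after [w1] and after [w2] leaves two arcs; [cycle_cross] traverses one of them
    backwards. *)
Lemma arc_split (s : seq T) w1 w2 : uniq s -> w1 \in s -> w2 \in s -> w1 != w2 ->
  exists i p1 p2, [/\ rot i s = (next s w1 :: p1) ++ next s w2 :: p2,
    last (next s w1) p1 = w2 & last (next s w2) p2 = w1].
Proof.
move=> Us w1s w2s w12.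
have n12 : next s w1 != next s w2 by rewrite (can_eq (prev_next Us)).
have [i p1 p2 _ _ def_rot] :=
  rot_to_arc Us (etrans (mem_next s w1) w1s) (etrans (mem_next s w2) w2s) n12.
exists i, p1, p2; have nextE := next_rot i Us.
have := cycle_next (p := rot i s); rewrite rot_uniq => /(_ Us).
rewrite def_rot cycle_cons_last cat_path last_cat /=.
case/andP=> /and3P[_ /eqP l1 _] /eqP l2.
split=> //; apply: (can_inj (prev_next Us)); rewrite -nextE ?def_rot //.
Qed.

Lemma cycle_insert (s : seq T) w x q : uniq s -> cycle e s -> w \in s -> path e x q ->
  e w x -> e (last x q) (next s w) ->
  exists2 s', cycle e s' & perm_eq s' (s ++ x :: q).
Proof.
move=> Us Cs ws Pq wx lw.
have [i p def_rot] := rot_to (etrans (mem_next s w) ws).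
exists ((next s w :: p) ++ x :: q); last by rewrite perm_cat2r -def_rot perm_rot.
have lp : last (next s w) p = w.
  have := cycle_next (p := rot i s); rewrite rot_uniq => /(_ Us).
  rewrite def_rot cycle_cons_last => /andP[_ /eqP]; rewrite -def_rot next_rot //.
  exact: (can_inj (prev_next Us)).
move: Cs; rewrite -(rot_cycle i) def_rot !cycle_cons_last cat_path last_cat /=.
by case/andP=> -> _; rewrite lp wx Pq lw.
Qed.

(** The new cycle follows the arc from [next s w1] to [w2], the path backwards to [x], then the
    other arc backwards from [w1] to [next s w2], and closes by the edge between the two
    successors. *)
Lemma cycle_cross (s : seq T) w1 w2 x q : uniq s -> cycle e s -> w1 \in s -> w2 \in s ->
  w1 != w2 -> path e x q -> e w1 x -> e w2 (last x q) ->
  e (next s w1) (next s w2) ->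
  exists2 s', cycle e s' & perm_eq s' (s ++ x :: q).
Proof.
move=> Us Cs w1s w2s w12 Pq w1x w2l n12.
have [i [p1 [p2 [def_rot l1 l2]]]] := arc_split Us w1s w2s w12.
exists ((next s w1 :: p1) ++ rev (x :: q) ++ rev (next s w2 :: p2)); last first.
  apply: (@perm_trans _ (rot i s ++ x :: q)); last by rewrite perm_cat2r perm_rot.
  rewrite def_rot -catA perm_cat2l perm_catC.
  by apply: perm_cat; apply: permEl; apply: perm_rev.
move: Cs; rewrite -(rot_cycle i) def_rot !rev_belast !cat_cons !cycle_cons_last.
rewrite !cat_path !last_cat /= !cat_path !last_cat /= !last_rev_belast !path_rev_sym.
by rewrite l1 l2 => /andP[/and3P[-> _ ->] _]; rewrite Pq w2l e_sym w1x e_sym n12.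
Qed.
End Cycles.

(** * Consequences of toughness *)

Section Tough.
Variables (T : finType) (e : rel T).
Hypothesis e_simple : simple_graph e.
Let e_sym : symmetric e := proj1 e_simple.
Let e_irr : irreflexive e := proj2 e_simple.

Definition nbr (x : T) : {set T} := [set y | e x y].

Definition indep (I : {set T}) := forall x y, x \in I -> y \in I -> ~~ e x y.

(** Once [S] is deleted, each vertex of [B] is a component of its own, hence its own root; a vertex
    outside [B] and [S] has a further root. *)
Lemma ncomp_isolated (B S : {set T}) : [disjoint B & S] ->
  (forall x, x \in B -> nbr x \subset S) ->
  #|B| <= ncomp_del e S /\ (~: (B :|: S) != set0 -> #|B| < ncomp_del e S).
Proof.
move=> disBS nbrB; set r := del_rel e S; set R := [predI roots r & ~: S].
have r_sym : symmetric r.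
  by move=> x y; rewrite /r /del_rel /= e_sym; case: (x \in S); case: (y \in S).
have isol x y : x \in B -> connect r x y -> y = x.
  move=> xB /connectP[[|z p] //= /andP[/and3P[_ zS xz] _] _].
  by case/negP: zS; apply: (subsetP (nbrB x xB)); rewrite inE.
have sBR : B \subset R.
  apply/subsetP => x xB; rewrite !inE (disjointFr disBS xB) andbT.
  by apply/eqP; apply: isol => //; apply: connect_root.
have -> : ncomp_del e S = #|R| by [].
split=> [|/set0Pn[z]]; first exact: subset_leq_card.
rewrite !inE negb_or => /andP[zB zS]; apply: proper_card; rewrite properE sBR /=.
have r_csym := sym_connect_sym r_sym; have zr := connect_root r z.
apply/subsetPn; exists (fingraph.root r z).
  rewrite !inE roots_root //=.
  have /connectP[p] := zr; case/lastP: p => [_ -> //|p y].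
  by rewrite rcons_path last_rcons => /andP[_ /and3P[_ yS _]] ->.
by apply: contra zB => rB; have -> // : z = fingraph.root r z; apply: isol rB _; rewrite r_csym.
Qed.

Hypothesis e_tough : tough e (2%:R)%R.

(** Toughness speaks only of deletions that leave at least two components; the last premise supplies
    the second one. *)
Lemma tough_isolated (B S : {set T}) : [disjoint B & S] ->
  (forall x, x \in B -> nbr x \subset S) -> B != set0 ->
  1 < #|B| \/ ~: (B :|: S) != set0 -> 2 * #|B| <= #|S|.
Proof.
move=> disBS nbrB B0 many; have [leB ltB] := ncomp_isolated disBS nbrB.
have B1 : 0 < #|B| by rewrite card_gt0.
have /e_tough : 1 < ncomp_del e S.
  by case: many => [|/ltB]; lia.
by rewrite -GRing.natrM Num.Theory.ler_nat; lia.
Qed.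

Hypothesis T_ge3 : 3 <= #|T|.

Lemma indep_third (I : {set T}) : indep I -> 3 * #|I| <= #|T|.
Proof.
move=> indI; have [le1|gt1] := leqP #|I| 1; first by lia.
have := @tough_isolated I (~: I); have := cardsC I.
have -> : [disjoint I & ~: I] by rewrite -setI_eq0 setICr.
have -> : I != set0 by rewrite -card_gt0; lia.
have nbrI x : x \in I -> nbr x \subset ~: I.
  move=> xI; apply/subsetP => y; rewrite !inE => xy; apply/negP => yI.
  by have := indI x y xI yI; rewrite xy.
by move=> cI /(_ isT nbrI isT (or_introl gt1)); lia.
Qed.

Lemma nbr_neq0 x : nbr x != set0.
Proof.
apply/negP => /eqP nx0; have := @tough_isolated [set x] set0.
rewrite cards0 cards1 setU0 -card_gt0 cards1 => H.
suff: 2 * 1 <= 0 by [].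
apply: H => //; first by rewrite -setI_eq0 setI0.
  by move=> y /set1P ->; rewrite nx0.
by right; rewrite -card_gt0; have := cardsC [set x]; rewrite cards1; lia.
Qed.

(** * Vertices of low degree and a cycle through them *)

Hypothesis e_2K2 : twoK2_free e.

(** If the two edges share a vertex, one of them is itself a cross edge; otherwise the four vertices
    are distinct and would induce a 2K2. *)
Lemma twoK2_edge a b c d : e a b -> e c d -> [|| e a c, e a d, e b c | e b d].
Proof.
move=> ab cd; apply/negPn/negP => ncross; apply: e_2K2; exists a, b, c, d.
split=> //; move: ncross; rewrite !negb_or => /and4P[ac ad bc bd].
rewrite /= !inE !negb_or !andbT -!andbA; apply/and5P; split; last (apply/andP; split).
- by apply: contraTneq ab => ->; rewrite e_irr.
- by apply: contraNneq ad => ->.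
- by apply: contraNneq ac => ->; rewrite e_sym.
- by apply: contraNneq bd => ->.
- by apply: contraNneq bc => ->; rewrite e_sym.
- by apply: contraTneq cd => ->; rewrite e_irr.
Qed.

Definition low : {set T} := [set v | 3 * #|nbr v| < #|T|].

Lemma low_indep : indep low.
Proof.
move=> x y; rewrite !inE => lx ly; apply/negP => xy.
have indI : indep (~: (nbr x :|: nbr y)).
  move=> c d; rewrite !inE !negb_or => /andP[xc yc] /andP[xd yd]; apply/negP => cd.
  by have := twoK2_edge xy cd; rewrite (negPf xc) (negPf yc) (negPf xd) (negPf yd).
have := indep_third indI; have := cardsC (nbr x :|: nbr y).
by have := cardsU (nbr x) (nbr y); lia.
Qed.

(** Hall's theorem is applied to pairs of a low vertex and a boolean, so that each low vertex asks
    for two neighbours. Deleting the neighbours of [B] isolates [B], so Hall's condition follows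
    from toughness. *)
Lemma low_cherries : exists a b : T -> T,
  [/\ {in low, forall v, e v (a v) && e v (b v)}, {in low &, injective a},
      {in low &, injective b} & {in low &, forall v w, a v != b w}].
Proof.
have /card_gt0P[t0 _] : 0 < #|T| by lia.
have [|f f_inj fN] := @hall_sdr _ _ t0 (fun p : T * bool => nbr p.1)
  [set p : T * bool | p.1 \in low]; last first.
  exists (fun v => f (v, true)), (fun v => f (v, false)); split.
  - move=> v vL; have := fN (v, true); have := fN (v, false).
    by rewrite !inE /=; move: vL; rewrite inE => vL /(_ vL) -> /(_ vL) ->.
  - by move=> v w; rewrite !inE => vL wL /f_inj; rewrite !inE => /(_ vL wL)[].
  - by move=> v w; rewrite !inE => vL wL /f_inj; rewrite !inE => /(_ vL wL)[].
  - move=> v w; rewrite !inE => vL wL; apply/eqP => /f_inj.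
    by rewrite !inE => /(_ vL wL).
move=> J sJ; set S := \bigcup_(i in J) _; set B := [set p.1 | p in J].
have sBL : B \subset low.
  by apply/subsetP => _ /imsetP[p pJ ->]; have := subsetP sJ p pJ; rewrite inE.
have leJ : #|J| <= 2 * #|B|.
  rewrite mulnC -card_bool -cardsT -cardsX; apply: subset_leq_card.
  by apply/subsetP => p pJ; rewrite !inE andbT; apply: imset_f.
have [->|B0] := eqVneq J set0; first by rewrite cards0.
have {B0}/set0Pn[p pJ] := B0.
apply: leq_trans leJ _; apply: tough_isolated.
- rewrite -setI_eq0; apply/eqP/setP => x; rewrite !inE; apply/negP => /andP[xB].
  case/bigcupP => q qJ; rewrite inE => qx.
  have := low_indep (subsetP sBL _ (imset_f fst qJ)) (subsetP sBL _ xB).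
  by rewrite qx.
- by move=> _ /imsetP[q qJ ->]; apply: (bigcup_sup q).
- by apply/set0Pn; exists p.1; apply: imset_f.
have [gt1|le1] := ltnP 1 #|B|; [by left|right].
(* A single vertex in [B] has fewer than n/3 neighbours, so some vertex remains outside
   [B :|: S]. *)
have pB : p.1 \in B by apply: imset_f.
have sS : S \subset nbr p.1.
  apply/bigcupsP => q qJ; have qB : q.1 \in B by apply: imset_f.
  by rewrite (card_le1_eqP le1 _ _ qB pB).
rewrite -card_gt0; have := cardsC (B :|: S); have := cardsU B S.
have := subset_leq_card sS; have := subsetP sBL _ pB; rewrite inE; lia.
Qed.

(** Induction adds one cherry at a time. Keeping the second and the last but one vertex in [low]
    allows either end to be dropped; the last inclusion keeps the path disjoint from the cherries
    still to come. *)
Lemma low_path (a b : T -> T) (ks : seq T) :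
  {in low, forall v, e v (a v) && e v (b v)} -> ks != [::] ->
  {subset ks <= low} -> uniq (flatten [seq [:: a v; v; b v] | v <- ks]) ->
  exists x v q y, [/\ uniq [:: x, v & rcons q y], path e x (v :: rcons q y),
    v \in low, last v q \in low & {subset ks <= v :: q} /\
    {subset [:: x, v & rcons q y] <= flatten [seq [:: a v; v; b v] | v <- ks]}].
Proof.
move=> abN; elim: ks => // v0 ks IH _ ksL.
have v0L : v0 \in low by apply: ksL; rewrite mem_head.
have /andP[av bv] := abN _ v0L; set a0 := a v0; set b0 := b v0.
have [->|ks0] := eqVneq ks [::].
  move=> U; exists a0, v0, [::], b0; split=> //=.
    by rewrite e_sym av bv.
  by split.
set fl := flatten _ in IH *; rewrite cat_uniq.
case/and3P=> U0 /hasPn disj Uks.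
have ksL' : {subset ks <= low} by move=> w wks; apply: ksL; rewrite inE wks orbT.
have [x [v [q [y [U P vL lL [sub1 sub2]]]]]] := IH ks0 ksL' Uks.
have Ubig : uniq ([:: b0; v0; a0] ++ [:: x, v & rcons q y]).
  rewrite cat_uniq U andbT; apply/andP; split.
    by rewrite -(rev_uniq) in U0.
  apply/hasPn => w /sub2/disj; rewrite !inE !negb_or.
  by case/and3P=> -> -> ->.
move: P => /= /andP[xv P].
(* The three cases join the path whole, without [x], or without [a0]; the new path always starts
   with [b0], [v0]. *)
have := twoK2_edge (c := x) (d := v) (etrans (e_sym a0 v0) av) xv.
rewrite (negPf (low_indep v0L vL)) orbF => /or3P adj.
have big w : w \in [:: b0; v0; a0] ++ [:: x, v & rcons q y] ->
    w \in [:: a0; v0; b0] ++ fl.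
  rewrite !mem_cat => /orP[|/sub2->]; last by rewrite orbT.
  by rewrite !inE => /or3P[]->; rewrite ?orbT.
have Ksub p : {subset v :: q <= p} -> {subset v0 :: ks <= v0 :: p}.
  by move=> sp w; rewrite !inE => /orP[->//|/sub1/sp->]; rewrite orbT.
case: adj => adj.
- exists b0, v0, [:: a0, x, v & q], y; split=> //=.
    by rewrite e_sym bv av adj xv P.
  split; first by apply: Ksub => w; rewrite !inE => ->; rewrite !orbT.
  exact: big.
- have ss : subseq ([:: b0; v0; a0] ++ v :: rcons q y) _ :=
    cat_subseq (subseq_refl _) (subseq_cons _ x).
  exists b0, v0, [:: a0, v & q], y; split=> //=; first exact: subseq_uniq ss Ubig.
    by rewrite e_sym bv av adj P.
  split; first by apply: Ksub => w; rewrite !inE => ->; rewrite !orbT.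
  by move=> w /(mem_subseq ss)/big.
- have ss : subseq ([:: b0; v0] ++ [:: x, v & rcons q y]) _ :=
    cat_subseq (subseq_refl _) (subseq_cons _ a0).
  exists b0, v0, [:: x, v & q], y; split=> //=; first exact: subseq_uniq ss Ubig.
    by rewrite e_sym bv adj xv P.
  split; first by apply: Ksub => w; rewrite !inE => ->; rewrite !orbT.
  by move=> w /(mem_subseq ss)/big.
Qed.

Lemma low_cycle : exists s : seq T,
  [/\ uniq s, cycle e s, s != [::] & {subset low <= s}].
Proof.
(* With at most one low vertex an edge suffices: [cycle] accepts the two-vertex sequence that walks
   an edge back and forth. *)
have [le1|gt1] := leqP #|low| 1.
  have [v lowv] : exists v, {subset low <= [:: v]}.
    have [low0|[v vL]] := set_0Vmem low; last first.
      by exists v => w wL; rewrite inE (card_le1_eqP le1 _ _ vL wL).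
    have /card_gt0P[v _] : 0 < #|T| by lia.
    by exists v => w; rewrite low0 inE.
  have /set0Pn[w] := nbr_neq0 v; rewrite inE => vw.
  exists [:: v; w]; split=> //=; last 1 first.
  - by move=> u /lowv; rewrite !inE => ->.
  - by rewrite inE andbT; apply: contraTneq vw => <-; rewrite e_irr.
  - by rewrite vw e_sym vw.
have [a [b [abN a_inj b_inj ab]]] := low_cherries.
have ks0 : enum low != [::] by rewrite -size_eq0 -cardE; lia.
have ksL : {subset enum low <= low} by move=> v; rewrite mem_enum.
have Uks : uniq (flatten [seq [:: a v; v; b v] | v <- enum low]).
  have aN v : v \in low -> e v (a v) by move=> /abN/andP[].
  have bN v : v \in low -> e v (b v) by move=> /abN/andP[].
  have lowN v w x : v \in low -> w \in low -> e v x -> w != x.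
    by move=> vL wL; apply: contraTneq => <-; apply: low_indep.
  have := enum_uniq low; elim: (enum low) ksL => //= v ks IH ksL /andP[vks Uks].
  have vL : v \in low by apply: ksL; rewrite mem_head.
  have ksL' : {subset ks <= low} by move=> w wks; apply: ksL; rewrite inE wks orbT.
  have N w : w \in ks -> [/\ w \in low, v != w & w != v].
    move=> wks; rewrite ksL' //; split=> //; apply: contraNneq vks => vw;
      by [rewrite vw | rewrite -vw].
  rewrite IH // andbT !inE !negb_or (ab v v) // (lowN v v) //; last exact: bN.
  rewrite (eq_sym (a v)) (lowN v v) ?aN //=; apply/and3P; split.
  - apply/flatten_mapP => -[w /N[wL vw _]]; rewrite !inE.
    rewrite (negPf (ab v w vL wL)) (inj_in_eq a_inj) // (negPf vw).
    by rewrite eq_sym (negPf (lowN v w (a v) vL wL (aN v vL))).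
  - apply/flatten_mapP => -[w /N[wL vw _]]; rewrite !inE (negPf vw).
    by rewrite (negPf (lowN w v (a w) _ _ _)) ?(negPf (lowN w v (b w) _ _ _)) ?aN ?bN.
  - apply/flatten_mapP => -[w /N[wL vw _]]; rewrite !inE.
    rewrite (inj_in_eq b_inj) // (negPf vw) !(eq_sym (b v)).
    by rewrite (negPf (ab w v wL vL)) (negPf (lowN v w (b v) vL wL (bN v vL))).
have [x [v [q [y [U P vL lL [sub _]]]]]] := low_path abN ks0 ksL Uks.
have sub' : {subset low <= v :: q} by move=> w wL; apply: sub; rewrite mem_enum.
move: P; rewrite /= rcons_path => /and3P[xv Pq ly].
(* The end edges of the path close it in the same way: whole, without [y], or without [x]. *)
have := twoK2_edge (c := y) xv (etrans (e_sym _ _) ly).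
have -> : e v (last v q) = false by apply/negbTE/low_indep.
rewrite orbF => /or3P[xy|xl|vy].
- exists [:: x, v & rcons q y]; split=> //.
    by rewrite cycle_cons_last /= rcons_path last_rcons xv Pq ly e_sym.
  by move=> w /sub'; rewrite !inE mem_rcons inE => /orP[->|->]; rewrite ?orbT.
- exists [:: x, v & q]; split=> //.
  + by move: U; rewrite -!rcons_cons rcons_uniq => /andP[].
  + by rewrite cycle_cons_last /= xv Pq e_sym.
  + by move=> w /sub'; rewrite [in X in _ -> X]inE => ->; rewrite orbT.
- exists (v :: rcons q y); split=> //.
  + by move: U => /= /andP[].
  + by rewrite cycle_cons_last rcons_path last_rcons Pq ly e_sym.
  + by move=> w /sub'; rewrite !inE mem_rcons inE => /orP[->|->]; rewrite ?orbT.
Qed.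

(** * A longest cycle through the low vertices *)

Definition linked (s : seq T) (x y : T) :=
  exists q, [/\ uniq (x :: q), all [predC s] (x :: q), path e x q & last x q = y].

(** Maximality is asked only among cycles that keep all vertices of [s], which is what both
    reroutings produce. *)
Lemma longest_cycle_spans (s : seq T) : uniq s -> cycle e s -> s != [::] ->
  {subset low <= s} ->
  (forall s', uniq s' -> cycle e s' -> {subset s <= s'} -> size s' <= size s) ->
  forall x, x \in s.
Proof.
move=> Us Cs s0 lows longest x; apply/negPn/negP => xs.
have longestN q z s' : uniq (z :: q) -> all [predC s] (z :: q) ->
  cycle e s' -> ~ perm_eq s' (s ++ z :: q).
  move=> U; rewrite all_predC => D C p; have := longest s'.
  rewrite (perm_uniq p) cat_uniq Us U D (perm_size p) size_cat /=.
  have sub : {subset s <= s'} by move=> w ws; rewrite (perm_mem p) mem_cat ws.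
  by move=> /(_ isT C sub); lia.
have next_in w : w \in s -> next s w \in s by rewrite mem_next.
have next_inj : injective (next s) := can_inj (prev_next Us).
have not_ins y z w : linked s y z -> w \in s -> e y w -> ~~ e z (next s w).
  move=> [q [U D Pq <-]] ws yw; apply/negP => zw; rewrite e_sym in yw.
  by have [s' /longestN] := cycle_insert Us Cs ws Pq yw zw; apply.
have not_cross y z w1 w2 : linked s y z -> w1 \in s -> w2 \in s ->
    e y w1 -> e z w2 -> ~~ e (next s w1) (next s w2).
  move=> [q [U D Pq <-]] w1s w2s yw1 zw2; have [->|w12] := eqVneq w1 w2.
    by rewrite e_irr.
  rewrite e_sym in yw1; rewrite e_sym in zw2; apply/negP => n12.
  by have [s' /longestN] := cycle_cross e_sym Us Cs w1s w2s w12 Pq yw1 zw2 n12; apply.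
have neq z t : e z t -> z != t by apply: contraTneq => ->; rewrite e_irr.
have linked0 z : z \notin s -> linked s z z by move=> zs; exists [::]; rewrite /= zs.
have linked1 z t : z \notin s -> t \notin s -> e z t -> linked s z t.
  by move=> zs ts zt; exists [:: t]; rewrite /= zs ts zt inE neq.
have [y xy ys] : exists2 y, e x y & y \notin s.
  set A := [set w in s | e x w].
  have indA : indep (x |: next s @: A).
    move=> u v; have xA w : w \in A -> ~~ e x (next s w).
      by rewrite inE => /andP[ws xw]; apply: not_ins (linked0 x xs) ws xw.
    case/setU1P=> [->|/imsetP[w1 w1A ->]]; case/setU1P=> [->|/imsetP[w2 w2A ->]].
    + by rewrite e_irr.
    + exact: xA.
    + by rewrite e_sym; apply: xA.
    + move: w1A w2A; rewrite !inE => /andP[w1s xw1] /andP[w2s xw2].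
      exact: not_cross (linked0 x xs) w1s w2s xw1 xw2.
  (* Independence gives 3(#|A| + 1) <= n, while [x], not being low, has at least n/3 neighbours; so
     one of them is off the cycle. *)
  have := indep_third indA; rewrite cardsU1 card_imset // => leA.
  have xA : x \notin next s @: A.
    by apply: contra xs => /imsetP[w wA ->]; move: wA; rewrite inE mem_next => /andP[].
  have : x \notin low by apply: contra xs; apply: lows.
  rewrite inE -leqNgt => xlow.
  have /subsetPn[y] : ~~ (nbr x \subset A).
    by apply/negP => /subset_leq_card; move: leA; rewrite xA; lia.
  by rewrite !inE => xy; rewrite xy andbT => ys; exists y.
pose M := [set w in s | e x w || e y w]; pose B := next s @: M.
have xy_out z : z \in [:: x; y] -> z \notin s by rewrite !inE => /orP[]/eqP->.
have xy_linked z t : z \in [:: x; y] -> t \in [:: x; y] -> linked s z t.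
  rewrite !inE => /orP[]/eqP-> /orP[]/eqP->; by [apply: linked0 | apply: linked1; rewrite // e_sym].
have inM w : w \in M -> w \in s /\ exists2 z, z \in [:: x; y] & e z w.
  rewrite inE => /andP[ws /orP[]zw]; split=> //; [exists x | exists y] => //.
    by rewrite mem_head.
  by rewrite !inE eqxx orbT.
have nadjB z b : z \in [:: x; y] -> b \in B -> ~~ e z b.
  move=> zxy /imsetP[w /inM[ws [t txy tw]] ->].
  exact: not_ins (xy_linked _ _ txy zxy) ws tw.
have sB b : b \in B -> b \in s.
  by case/imsetP=> w /inM[ws _] ->; apply: next_in.
have disBM : [disjoint B & M].
  apply/pred0P => b /=; apply/andP => -[bB /inM[_ [z zxy zb]]].
  by move: (nadjB z b zxy bB); rewrite zb.
have xin : x \in [:: x; y] by rewrite mem_head.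
have yin : y \in [:: x; y] by rewrite !inE eqxx orbT.
(* If [prev s w] is not in [M], the edge from it to [w] and the edge [x y] force [w] into [M]. *)
have alternate w : w \in s -> w \in M \/ w \in B.
  move=> ws; have [|w'M] := boolP (prev s w \in M).
    by move=> w'M; right; rewrite -(next_prev Us w); apply: imset_f.
  left; have w's : prev s w \in s by rewrite mem_prev.
  have := next_cycle Cs w's; rewrite next_prev // => /(twoK2_edge xy).
  move: w'M; rewrite !inE w's ws /= negb_or => /andP[/negPf-> /negPf->].
  by rewrite orFb /=; case/orP=> ->; rewrite ?orbT.
have nbrB b : b \in B -> nbr b \subset M.
  move=> bB; apply/subsetP => o; rewrite inE => bo.
  have [w /inM[ws [z zxy zw]] eqb] := imsetP bB.
  have [os|os] := boolP (o \in s).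
    have [//|/imsetP[w' /inM[w's [t txy tw']] eqo]] := alternate o os.
    have := not_cross z t w w' (xy_linked _ _ zxy txy) ws w's zw tw'.
    by rewrite -eqb -eqo bo.
  have oxy t : t \in [:: x; y] -> o != t.
    by move=> txy; apply: contraTneq bo => ->; rewrite e_sym; apply: nadjB.
  (* For [o] off the cycle, the edges [b o] and [x y] make [o] adjacent to some [t] among [x], [y].
     The path from [z] to [o], through [t] if [t] is not [z], could then be inserted between [w] and
     [b]. *)
  have [t txy to] : exists2 t, t \in [:: x; y] & e t o.
    have := twoK2_edge bo xy; rewrite !(e_sym b) !(e_sym o).
    rewrite (negPf (nadjB x b xin bB)) (negPf (nadjB y b yin bB)) /=.
    by case/orP; [exists x | exists y].
  have : linked s z o.
    have [<-|zt] := eqVneq t z; first exact: linked1 (xy_out _ txy) os to.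
    have ezt : e z t.
      move: zxy txy zt; rewrite !inE => /orP[]/eqP-> /orP[]/eqP->; rewrite ?eqxx //.
      by rewrite e_sym.
    exists [:: t; o]; rewrite /= !inE (xy_out _ zxy) (xy_out _ txy) os ezt to.
    by rewrite negb_or (neq _ _ ezt) (neq _ _ to) (eq_sym z) oxy.
  by move/not_ins => /(_ w ws zw); rewrite -eqb e_sym bo.
have [w ws] : exists w, w \in s by case: (s) s0 => // w s1 _; exists w; rewrite mem_head.
have B0 : B != set0.
  have [wM|wB] := alternate w ws; last by apply/set0Pn; exists w.
  by apply/set0Pn; exists (next s w); apply: imset_f.
have cardB : #|B| = #|M| := card_imset _ next_inj.
suff : 2 * #|B| <= #|M| by move: B0; rewrite -card_gt0 cardB; lia.
(* The vertex [x] survives outside [B] and [M] and gives the extra component. *)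
apply: tough_isolated disBM nbrB B0 _; right; apply/set0Pn; exists x.
rewrite in_setC in_setU negb_or inE (negPf xs) andbT.
by apply: contra xs; apply: sB.
Qed.
End Tough.

(** * Choice of a longest cycle *)

Theorem theorem7 (T : finType) (e : rel T) :
  simple_graph e -> (3 <= #|T|)%N -> tough e (2%:R)%R -> twoK2_free e ->
  hamiltonian e.
Proof.
move=> e_simple T_ge3 e_tough e_2K2.
have [s0 [Us0 Cs0 s0n lows0]] := low_cycle e_simple e_tough T_ge3 e_2K2.
(* Nonemptiness is demanded separately because [low] may be empty; lengths are bounded by [#|T|]
   since the sequences are duplicate-free. *)
pose good n := [exists t : n.-tuple T, [&& uniq t, cycle e t, t != [::] :> seq T &
  all [in tval t] (enum (low e))]].
have good0 : exists n, good n.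
  exists (size s0); apply/existsP; exists (in_tuple s0); rewrite Us0 Cs0 s0n /=.
  by apply/allP => v; rewrite mem_enum => /lows0.
have le_good n : good n -> n <= #|T|.
  by case/existsP=> t /andP[/card_uniqP Ut _]; have := max_card (mem t); rewrite Ut size_tuple.
case: (ex_maxnP good0 le_good) => n /existsP[t /and4P[Ut Ct tn /allP lowt]] max_n.
exists t; split=> //.
have lows : {subset low e <= t} by move=> v vL; apply: lowt; rewrite mem_enum.
apply: (longest_cycle_spans e_simple e_tough T_ge3 e_2K2 Ut Ct tn lows) => s Us Cs sub.
rewrite size_tuple; apply: max_n; apply/existsP; exists (in_tuple s).
rewrite Us Cs /=; apply/andP; split.
  by case: (tval t) tn sub => // v t' _ /(_ v (mem_head _ _)); case: (s).
by apply/allP => v; rewrite mem_enum => /lows/sub.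
Qed.
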